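(* Assume the setting described in the context, and suppose that $(\rho,\sim)$ is strongly commutative and satisfies either the Algorithmic LLL condition or Shearer's condition, with constant $\theta\in(0,1)$. Let $\omega^{\mathrm{init}}$ be an arbitrary initial distribution and define $\gamma^{\mathrm{init}}=\max_{\sigma\in\Omega}\omega^{\mathrm{init}}(\sigma)/\omega(\sigma)$. Let $$T=\frac{1}{\log\theta^{-1}}\Big(\log\gamma^{\mathrm{init}}+\log\sum_{f\in F}\mu_f\Big),$$ where, in the case of Shearer's condition, $\mu_f=q_{\{f\}}(p)/q_\varnothing(p)$. Then for every $r$ the following holds, whatever rule is used for picking $f$ inside a round: the probability that Algorithm 2 produces a flawless object in fewer than $T+r$ rounds is at least $1-\theta^r$.
   Context: Setting: $\Omega$ is a finite set of objects and $F$ is a finite set of flaws, each a nonempty subset of $\Omega$; $F_\sigma=\{f\in F:\sigma\in f\}$, and $\sigma$ is flawless if $F_\sigma=\varnothing$. For $\sigma\in\Omega$ and $f\in F_\sigma$ a probability distribution $\rho(\cdot\mid f,\sigma)$ on $\Omega$ is given, with support $A(f,\sigma)$. A probability distribution $\omega$ on $\Omega$ satisfies $\omega(\sigma)>0$ for all $\sigma$. We write $\sigma\xrightarrow{f}\sigma'$ when $f\in F_\sigma$ and $\sigma'\in A(f,\sigma)$. A symmetric relation $\sim$ on $F$ is fixed (loops allowed), with $\Gamma(f)=\{g:f\sim g\}$, $\Gamma^+(f)=\Gamma(f)\cup\{f\}$ and $\Gamma^+(S)=\bigcup_{f\in S}\Gamma^+(f)$. It is assumed that $(F,\sim)$ is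 a potential causality graph: for every $\sigma\xrightarrow{f}\sigma'$, $F_{\sigma'}\subseteq(F_\sigma\setminus\{f\})\cup\Gamma(f)$. A set $S\subseteq F$ is independent if $f\not\sim g$ for distinct $f,g\in S$; $\mathrm{Ind}(S)$ is the family of independent subsets of $S$. $(\rho,\sim)$ is weakly commutative if there is an injective map SWAP sending every walk $\sigma_1\xrightarrow{f}\sigma_2\xrightarrow{g}\sigma_3$ with $f\not\sim g$ to a walk $\sigma_1\xrightarrow{g}\sigma_2'\xrightarrow{f}\sigma_3$. It is strongly commutative if in addition $\rho(\sigma_2\mid f,\sigma_1)\rho(\sigma_3\mid g,\sigma_2)=\rho(\sigma_2'\mid g,\sigma_1)\rho(\sigma_3\mid f,\sigma_2')$ for every such walk and its image. Algorithmic LLL condition with constant $\theta$: there exist $\lambda,\mu\in\mathbb{R}^F$ with $\mu_f\ne0$ such that (i) $\lambda_f\ge\sum_{\sigma\in f:\,\sigma'\in A(f,\sigma)}\rho(\sigma'\mid f,\sigma)\omega(\sigma)/\omega(\sigma')$ for all $f,\sigma'$; (ii) $\frac{\lambda_f}{\mu_f}\sum_{S\in\mathrm{Ind}(\Gamma(f))}\prod_{g\in S}\mu_g\le\theta$ for all $f$. Shearer's condition with constant $\theta$: let $q_S(p)=\sum_{I:S\subseteq I\in\mathrm{Ind}(F)}(-1)^{|I|-|S|}\prod_{f\in I}p_f$. There must exist $p\in\mathbb{R}^F$ with $q_S(p)\ge0$ for all $S\subseteq F$ and $q_\varnothing(p)>0$, and $\lambda$ satisfying (i), with $\lambda_f\le\theta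 p_f$ for all $f$. Algorithm 2. Sample $\sigma$ from $\omega^{\mathrm{init}}$. While $F_\sigma\ne\varnothing$, perform a round: set $I=\varnothing$; while $F_\sigma\setminus\Gamma^+(I)\neq\varnothing$, pick some $f\in F_\sigma\setminus\Gamma^+(I)$, sample $\sigma'$ from $\rho(\cdot\mid f,\sigma)$, set $\sigma\leftarrow\sigma'$ and $I\leftarrow I\cup\{f\}$.
   Formalization: In the Algorithmic LLL condition every μ_f is required to be positive, not merely nonzero; r is restricted to T + r > 0 (the claim fails for r > 0 with T + r ≤ 0); picking rules are deterministic functions of the full history (randomized rules follow by averaging). *)

(* Defs.v *)
From HB Require Import structures.
From mathcomp Require Import all_boot all_order all_algebra.
From mathcomp Require classical_sets.
From mathcomp Require Import reals exp.
Set Implicit Arguments. Unset Strict Implicit. Unset Printing Implicit Defensive.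
Import Order.TTheory GRing.Theory Num.Theory.
Local Open Scope ring_scope.

Section LLLDefs.
Variables (R : realType) (Omega F : finType).
(* fl f = the subset of Omega that the flaw f is *)
Variable fl : F -> {set Omega}.
(* rho f s s' = rho(s' | f, s) *)
Variable rho : F -> Omega -> Omega -> R.
Variable sim : rel F.

Definition flaws_at (s : Omega) : {set F} := [set f | s \in fl f].
Definition flawless (s : Omega) : bool := flaws_at s == set0.

Definition Asupp (f : F) (s : Omega) : {set Omega} := [set s' | rho f s s' != 0].

Definition step (s : Omega) (f : F) (s' : Omega) : bool :=
  (s \in fl f) && (s' \in Asupp f s).

Definition Gam (f : F) : {set F} := [set g | sim f g].
Definition GamP (f : F) : {set F} := f |: Gam f.
Definition GamPS (S : {set F}) : {set F} := \bigcup_(f in S) GamP f.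

Definition indep (S : {set F}) : bool :=
  [forall f in S, forall g in S, (f != g) ==> ~~ sim f g].

Definition flaws_ok : Prop := injective fl /\ forall f, fl f != set0.

Definition rho_distr : Prop :=
  forall f s, s \in fl f ->
    (forall s', 0 <= rho f s s') /\ \sum_(s' : Omega) rho f s s' = 1.

Definition pos_distr (w : Omega -> R) : Prop :=
  (forall s, 0 < w s) /\ \sum_(s : Omega) w s = 1.

Definition distr (w : Omega -> R) : Prop :=
  (forall s, 0 <= w s) /\ \sum_(s : Omega) w s = 1.

Definition sym_rel : Prop := forall f g, sim f g = sim g f.

Definition potential_causality : Prop :=
  forall s f s', step s f s' ->
    flaws_at s' \subset (flaws_at s :\ f) :|: Gam f.

(* weak / strong commutativity: SWAP sends the walk s1 -f-> s2 -g-> s3 (f !~ g)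
   to s1 -g-> swap s1 f s2 g s3 -f-> s3, injectively. *)
Definition weakly_commutative_by (swap : Omega -> F -> Omega -> F -> Omega -> Omega) : Prop :=
  (forall s1 f s2 g s3, ~~ sim f g -> step s1 f s2 -> step s2 g s3 ->
     step s1 g (swap s1 f s2 g s3) /\ step (swap s1 f s2 g s3) f s3)
  /\
  (forall s1 f s2 t2 g s3, ~~ sim f g ->
     step s1 f s2 -> step s2 g s3 -> step s1 f t2 -> step t2 g s3 ->
     swap s1 f s2 g s3 = swap s1 f t2 g s3 -> s2 = t2).

Definition strongly_commutative : Prop :=
  exists swap, weakly_commutative_by swap /\
    forall s1 f s2 g s3, ~~ sim f g -> step s1 f s2 -> step s2 g s3 ->
      rho f s1 s2 * rho g s2 s3 =
      rho g s1 (swap s1 f s2 g s3) * rho f (swap s1 f s2 g s3) s3.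

Definition cond_i (omega : Omega -> R) (lam : F -> R) : Prop :=
  forall f s', \sum_(s | step s f s') rho f s s' * omega s / omega s' <= lam f.

Definition alg_LLL_cond (omega : Omega -> R) (theta : R) (mu : F -> R) : Prop :=
  exists lam : F -> R,
    (forall f, 0 < mu f) /\ cond_i omega lam /\
    forall f, lam f / mu f *
       (\sum_(S : {set F} | (S \subset Gam f) && indep S) \prod_(g in S) mu g)
       <= theta.

Definition qS (p : F -> R) (S : {set F}) : R :=
  \sum_(J : {set F} | indep J && (S \subset J))
     (-1) ^+ (#|J| - #|S|) * \prod_(f in J) p f.

Definition shearer_cond (omega : Omega -> R) (theta : R) (mu : F -> R) : Prop :=
  exists (p lam : F -> R),
    (forall S, 0 <= qS p S) /\ 0 < qS p set0 /\ cond_i omega lam /\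
    (forall f, lam f <= theta * p f) /\
    mu = (fun f => qS p [set f] / qS p set0).

(* A (deterministic, history-dependent) flaw-picking rule: it receives the
   initial object, the history of steps so far (flaw addressed, new object),
   the current object and the current set I of the round. *)
Definition strategy := Omega -> seq (F * Omega) -> Omega -> {set F} -> F.

Definition avail (s : Omega) (oI : option {set F}) : {set F} :=
  if oI is Some J then flaws_at s :\: GamPS J else set0.

Definition valid_strategy (strat : strategy) : Prop :=
  forall s0 h s J, flaws_at s :\: GamPS J != set0 ->
    strat s0 h s J \in flaws_at s :\: GamPS J.

(* run ok n s0 h s oI k: probability that, from the current configuration
   (object s, round state oI -- None = between rounds, Some I = inside a
   round with current set I -- and k rounds started so far), Algorithm 2
   terminates within n more sampling steps with a number of rounds k_fin
   satisfying ok k_fin. *)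
Fixpoint run (strat : strategy) (ok : nat -> bool) (n : nat) (s0 : Omega)
    (h : seq (F * Omega)) (s : Omega) (oI : option {set F}) (k : nat) : R :=
  if (avail s oI == set0) && flawless s then (if ok k then 1 else 0) else
  let J := if avail s oI == set0 then set0 else odflt set0 oI in
  let k' := if avail s oI == set0 then k.+1 else k in
  match n with
  | 0 => 0
  | n'.+1 =>
      let f := strat s0 h s J in
      \sum_(s' : Omega) rho f s s' *
          run strat ok n' s0 (rcons h (f, s')) s' (Some (f |: J)) k'
  end.

(* Probability that Algorithm 2 (initial distribution winit, rule strat)
   produces a flawless object after a number k of rounds with ok k:
   the limit (supremum) of the finite-horizon probabilities. *)
Definition prob_terminates (winit : Omega -> R) (strat : strategy) (ok : nat -> bool) : R :=
  sup (classical_sets.range (fun n => \sum_(s0 : Omega) winit s0 * run strat ok n s0 [::] s0 None 0)).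

Definition gamma_init (omega winit : Omega -> R) : R :=
  \big[Num.max/0]_(s : Omega) (winit s / omega s).

Definition Tbound (omega winit : Omega -> R) (theta : R) (mu : F -> R) : R :=
  (ln (gamma_init omega winit) + ln (\sum_(f : F) mu f)) / ln theta^-1.

End LLLDefs.

(* Main.v *)
(** For each flaw [f] let A_f be the substochastic matrix of the moves that
address [f]. Strong commutativity makes A_f and A_g commute when f and g are not
related by [sim]. Hence, in the flaw sequence of a run that
reaches round [m], only the causal past of the first flaw [f] of round [m]
matters: the remaining flaws can be commuted behind [f] and their matrices
discarded. This past, put in Foata normal form read backwards from [f], is a
sequence of exactly [m] nonempty independent sets J_1, ..., J_m = {f} with
J_i included in Gamma(J_{i+1}), and all runs of a fixed picking rule having
this past weigh together at most (A_{J_1} ... A_{J_m} 1)(sigma). Averaging over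
omega bounds this by the product of the lambda's, and both conditions make the
sum over all such sequences at most theta^m times the sum of the mu's. *)
Require Import Defs.
From HB Require Import structures.
From mathcomp Require Import all_boot all_order all_algebra.
From mathcomp Require classical_sets.
From mathcomp Require Import reals exp.
Set Implicit Arguments. Unset Strict Implicit. Unset Printing Implicit Defensive.
Import Order.TTheory GRing.Theory Num.Theory.
Local Open Scope ring_scope.

(** * Comparison of sums along injections, and an alternating sum *)

Lemma ler_sum_inj (R : numDomainType) (I J : finType) (P : pred I) (Q : pred J)
    (h : I -> J) (F : I -> R) (G : J -> R) :
  {in P &, injective h} ->
  (forall i, P i -> F i != 0 -> Q (h i)) ->
  (forall i, P i -> F i <= G (h i)) ->
  (forall j, Q j -> 0 <= G j) ->
  \sum_(i | P i) F i <= \sum_(j | Q j) G j.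
Proof.
move=> hinj PQ FG G0; pose A := [set i | P i && (F i != 0)].
have -> : \sum_(i | P i) F i = \sum_(i in A) F i.
  rewrite (bigID (fun i => F i != 0)) /= [X in _ + X]big1 ?addr0.
    by apply: eq_bigl => i; rewrite inE.
  by move=> i /andP[_]; rewrite negbK => /eqP.
apply: (@le_trans _ _ (\sum_(i in A) G (h i))).
  by apply: ler_sum => i; rewrite inE => /andP[/FG].
rewrite -(big_imset G); last first.
  by move=> i j; rewrite !inE => /andP[Pi _] /andP[Pj _]; apply: hinj.
have sub j : j \in h @: A -> Q j.
  by case/imsetP=> i; rewrite inE => /andP[Pi Fi] ->; apply: PQ.
rewrite [leRHS](bigID (mem (h @: A))) /=.
have -> : \sum_(j in h @: A) G j = \sum_(j | Q j && (j \in h @: A)) G j.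
  by apply: eq_bigl => j; case: (boolP (j \in _)) => [/sub ->|]; rewrite ?andbF.
by rewrite lerDl sumr_ge0 // => j /andP[/G0].
Qed.

Lemma big_tuple_cons (R : nmodType) (T : finType) d (Phi : d.+1.-tuple T -> R) :
  \sum_J Phi J = \sum_(J : d.-tuple T) \sum_x Phi (cons_tuple x J).
Proof.
rewrite pair_bigA /= (reindex (fun p : d.-tuple T * T => cons_tuple p.2 p.1)) //.
exists (fun t => (behead_tuple t, thead t)) => [[J x] _|J _] /=.
  by congr pair; apply: val_inj.
by case/tupleP: J => x J; apply: val_inj.
Qed.

(** The sum is the expansion of the product of [a f + 1] over all [f], with [a] equal to -1 on [K]
    and to 0 elsewhere; each element of [K] contributes a zero factor. *)
Lemma sum_sign_subset (R : comPzRingType) (F : finType) (K : {set F}) :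
  \sum_(S : {set F} | S \subset K) (-1) ^+ #|S| = (K == set0)%:R :> R.
Proof.
pose a f : R := if f \in K then - 1 else 0.
have E : \prod_f (a f + 1) = (K == set0)%:R.
  have [K0|/set0Pn[f fK]] := eqVneq K set0.
    by rewrite big1 // => f _; rewrite /a K0 inE add0r.
  by rewrite (bigD1 f) //= /a fK addNr mul0r.
rewrite -E bigA_distr big_mkcond /=; apply: eq_bigr => S _.
case: ifPn => [SK|/subsetPn[f fS fK]]; last first.
  by rewrite (bigD1 f) //= fS /a (negPf fK) mul0r.
rewrite -big_mkcond /= -prodr_const; apply: eq_bigr => f fS.
by rewrite /a (subsetP SK).
Qed.

(** * Matrices of the moves that address a flaw *)

Section Operators.
Variables (R : realType) (Omega F : finType) (fl : F -> {set Omega}).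
Variables (rho : F -> Omega -> Omega -> R) (sim : rel F).
Hypothesis rhoP : rho_distr fl rho.

Local Notation step := (step fl rho).

(** The matrix A_f applied to the function [u]. Summing over [step] makes it vanish at objects
    without the flaw [f], so A_f is substochastic. *)
Definition act (f : F) (u : Omega -> R) (s : Omega) : R :=
  \sum_(s' | step s f s') rho f s s' * u s'.

Definition acts (l : seq F) (u : Omega -> R) : Omega -> R := foldr act u l.

Lemma step_rho_ge0 s f s' : step s f s' -> 0 <= rho f s s'.
Proof. by case/andP=> /rhoP[]. Qed.

Lemma eq_act f u v : u =1 v -> act f u =1 act f v.
Proof. by move=> uv s; apply: eq_bigr => s' _; rewrite uv. Qed.

Lemma act_le f u v : (forall s, u s <= v s) -> forall s, act f u s <= act f v s.
Proof. by move=> uv s; apply: ler_sum => s' /step_rho_ge0 h; rewrite ler_wpM2l. Qed.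

Lemma act_ge0 f u : (forall s, 0 <= u s) -> forall s, 0 <= act f u s.
Proof. by move=> u0 s; apply: sumr_ge0 => s' /step_rho_ge0 h; rewrite mulr_ge0. Qed.

Lemma eq_acts l u v : u =1 v -> acts l u =1 acts l v.
Proof. by move=> uv; elim: l => //= f l; apply: eq_act. Qed.

Lemma acts_le l u v : (forall s, u s <= v s) -> forall s, acts l u s <= acts l v s.
Proof. by move=> uv; elim: l => //= f l; apply: act_le. Qed.

Lemma acts_ge0 l u : (forall s, 0 <= u s) -> forall s, 0 <= acts l u s.
Proof. by move=> u0; elim: l => //= f l; apply: act_ge0. Qed.

Lemma acts0 l : acts l (fun=> 0) =1 fun=> 0.
Proof.
elim: l => //= f l IH s; rewrite (eq_act f IH) /act big1 // => s' _.
by rewrite mulr0.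
Qed.

Lemma rho_sum_step s f (u : Omega -> R) : s \in fl f ->
  \sum_s' rho f s s' * u s' = act f u s.
Proof.
move=> sf; rewrite /act [RHS]big_mkcond; apply: eq_bigr => s' _.
rewrite /Defs.step sf inE /=; case: eqP => [->|] //=; exact: mul0r.
Qed.

Lemma act1 s f : s \in fl f -> act f (fun=> 1) s = 1.
Proof.
move=> sf; rewrite -rho_sum_step //; have [_ rho1] := rhoP sf; rewrite -[RHS]rho1.
by apply: eq_bigr => s' _; rewrite mulr1.
Qed.

Lemma act1_le f s : act f (fun=> 1) s <= 1.
Proof.
have [/act1 -> //|nsf] := boolP (s \in fl f).
by rewrite /act big_pred0 // => s'; rewrite /Defs.step (negPf nsf).
Qed.

Lemma act_act f g u s : act f (act g u) s =
  \sum_s3 u s3 * \sum_(s2 | step s f s2 && step s2 g s3) rho f s s2 * rho g s2 s3.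
Proof.
rewrite /act.
under eq_bigr => s2 _ do rewrite mulr_sumr big_mkcond.
rewrite exchange_big /=; apply: eq_bigr => s3 _.
rewrite mulr_sumr [RHS]big_mkcondr /=; apply: eq_bigr => s2 _.
by case: ifP => // _; rewrite mulrA mulrC.
Qed.

(** * Commutation of unrelated flaws *)

Section Commutation.
Hypothesis simC : sym_rel sim.
Hypothesis scomm : strongly_commutative fl rho sim.

(** [swap] injects the middle objects of the walks on the left into those on the right and preserves
    weights. The same bound with [f] and [g] exchanged gives the equality in [actC]. *)
Lemma walk2_le f g s1 s3 : ~~ sim f g ->
  \sum_(s2 | step s1 f s2 && step s2 g s3) rho f s1 s2 * rho g s2 s3 <=
  \sum_(s2 | step s1 g s2 && step s2 f s3) rho g s1 s2 * rho f s2 s3.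
Proof.
have [swap [[swapP swap_inj] swap_rho]] := scomm; move=> fg.
apply: (@ler_sum_inj _ _ _ _ _ (fun s2 => swap s1 f s2 g s3)).
- move=> s2 t2 /andP[a b] /andP[c d]; exact: swap_inj.
- by move=> s2 /andP[a b] _; apply/andP; apply: swapP.
- by move=> s2 /andP[a b]; rewrite swap_rho.
- by move=> s2 /andP[/step_rho_ge0 a /step_rho_ge0 b]; rewrite mulr_ge0.
Qed.

Lemma actC f g u : ~~ sim f g -> act f (act g u) =1 act g (act f u).
Proof.
move=> fg s; rewrite !act_act; apply: eq_bigr => s3 _; congr (_ * _).
by apply/eqP; rewrite eq_le !walk2_le // simC.
Qed.

Lemma act_actsC f l u : {in l, forall g, ~~ sim f g} ->
  act f (acts l u) =1 acts l (act f u).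
Proof.
elim: l => //= g l IH H s; rewrite actC ?H ?mem_head //; apply: eq_act.
by apply: IH => h hl; apply: H; rewrite inE hl orbT.
Qed.

Lemma acts_rem f l u : f \in l ->
  {in l, forall g, f != g -> ~~ sim f g} ->
  acts l u =1 act f (acts (rem f l) u).
Proof.
elim: l => //= g l IH; rewrite inE eq_sym => fgl H.
have Hl : {in l, forall h, f != h -> ~~ sim f h}.
  by move=> h hl; apply: H; rewrite inE hl orbT.
move: fgl; have [-> //|gf] := eqVneq g f; rewrite /= => fl0 s.
rewrite (eq_act g (IH fl0 Hl)) actC // simC; apply: H; first exact: mem_head.
by rewrite eq_sym.
Qed.

(** Makes [actS] insensitive to the order in which an independent set is enumerated. Only distinct
    flaws have to commute, so loops of [sim] do no harm. *)
Lemma perm_acts l1 l2 u : perm_eq l1 l2 ->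
  {in l1 &, forall f g, f != g -> ~~ sim f g} -> acts l1 u =1 acts l2 u.
Proof.
elim: l1 l2 => [|f l1 IH] l2 eql H.
  by rewrite perm_sym in eql; move/perm_nilP: eql => ->.
have fl2 : f \in l2 by rewrite -(perm_mem eql) mem_head.
have sub g : g \in l2 -> g \in f :: l1 by rewrite (perm_mem eql).
move=> s; rewrite [RHS](@acts_rem f) //; last first.
  by move=> g /sub; apply: H; rewrite mem_head.
apply: eq_act; apply: IH.
  by rewrite -(perm_cons f) (permPl eql) perm_to_rem.
by move=> g h gl hl; apply: H; rewrite inE ?gl ?hl orbT.
Qed.

(** * Independent sets addressed as one block *)

Definition actS (S : {set F}) : (Omega -> R) -> Omega -> R := acts (enum S).

Lemma indepP (S : {set F}) :
  reflect {in S &, forall f g, f != g -> ~~ sim f g} (indep sim S).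
Proof.
apply: (iffP forall_inP) => H f.
  by move=> g fS gS; move/forall_inP: (H f fS) => /(_ g gS) /implyP.
move=> fS; apply/forall_inP => g gS; apply/implyP; exact: H.
Qed.

Lemma actS_setU1 f (S : {set F}) u : f \notin S -> indep sim (f |: S) ->
  actS (f |: S) u =1 act f (actS S u).
Proof.
move=> fS /indepP fSi; apply: (perm_acts (l2 := f :: enum S)).
  apply: uniq_perm; rewrite ?enum_uniq //= ?enum_uniq ?mem_enum ?fS //.
  by move=> g; rewrite mem_enum !inE mem_enum.
by move=> g h; rewrite !mem_enum; apply: fSi.
Qed.

Lemma actSD1 f (S : {set F}) u : f \in S -> indep sim S ->
  actS S u =1 act f (actS (S :\ f) u).
Proof.
move=> fS Si s; rewrite -{1}(setD1K fS) actS_setU1 ?setD1K ?setD11 //.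
Qed.

Lemma actSD1r f (S : {set F}) u : f \in S -> indep sim S ->
  actS S u =1 actS (S :\ f) (act f u).
Proof.
move=> fS Si s; rewrite (actSD1 _ fS Si) act_actsC // => g.
rewrite mem_enum !inE => /andP[gf gS].
by move/indepP: Si => /(_ f g fS gS); apply; rewrite eq_sym.
Qed.

(** By causality, addressing [f] removes it when [sim] has no loop at [f], so it cannot be addressed
    again at once. *)
Lemma act_act0 f u : potential_causality fl rho sim -> ~~ sim f f ->
  act f (act f u) =1 fun=> 0.
Proof.
move=> caus nff s; rewrite /act big1 // => s' /caus sub.
rewrite big_pred0 ?mulr0 // => s''; apply/negP => /andP[s'f _].
have /(subsetP sub) : f \in flaws_at fl s' by rewrite inE.
by rewrite !inE eqxx (negPf nff).
Qed.

(** Independence lets [f] be the last flaw addressed in [S1] and the first one in [S2], where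
    [act_act0] applies. *)
Lemma actS_actS0 f (S1 S2 : {set F}) u : potential_causality fl rho sim ->
  ~~ sim f f -> f \in S1 -> f \in S2 -> indep sim S1 -> indep sim S2 ->
  actS S1 (actS S2 u) =1 fun=> 0.
Proof.
move=> caus nff f1 f2 i1 i2 s; rewrite (actSD1r _ f1 i1).
rewrite -[RHS](acts0 (enum (S1 :\ f)) s); apply: eq_acts => {}s.
by rewrite (eq_act f (actSD1 u f2 i2)) act_act0.
Qed.

(** * Causal pasts and the insertion of earlier flaws *)

(* Puts a flaw that is addressed earlier than those of [J] (earliest set first)
into the causal past recorded by [J]: it joins the set just before the first
one that it affects, and is dropped if it affects none. The head of [J] is
never supposed to be affected, which is ensured by padding with [set0]. *)
Fixpoint ins (f : F) (J : seq {set F}) : seq {set F} :=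
  if J is A :: J' then
    if J' is B :: _ then
      if [disjoint GamP sim f & B] then A :: ins f J' else (f |: A) :: J'
    else J
  else J.

Definition weight (J : seq {set F}) : Omega -> R := foldr actS (fun=> 1) J.

(* The head may be empty: the current round need not contribute to the past. *)
Fixpoint chain (J : seq {set F}) : bool :=
  if J is A :: J' then
    if J' is B :: _ then
      [&& A \subset GamPS sim B, indep sim A, B != set0 & chain J']
    else #|A| == 1%N
  else false.

Lemma actS0 u : actS set0 u = u.
Proof. by rewrite /actS enum_set0. Qed.

Lemma actS1 f u : actS [set f] u = act f u.
Proof. by rewrite /actS enum_set1. Qed.

Lemma weight_ge0 J s : 0 <= weight J s.
Proof. by elim: J s => [|S J IH] s /=; [exact: ler01 | exact: acts_ge0]. Qed.

Lemma disjoint_GamP f (S : {set F}) :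
  reflect (f \notin S /\ {in S, forall g, ~~ sim f g}) [disjoint GamP sim f & S].
Proof.
apply: (iffP idP) => [d|[fS H]].
  split=> [|g gS]; first by rewrite (disjointFr d) ?setU11.
  by have := disjointFl d gS; rewrite !inE => /norP[].
rewrite disjoint_subset; apply/subsetP => g; rewrite !inE => /orP[/eqP->|fg] //.
by apply/negP => /H; rewrite fg.
Qed.

Lemma indep_setU1 f (S : {set F}) : indep sim S ->
  [disjoint GamP sim f & S] -> indep sim (f |: S).
Proof.
move=> /indepP Si /disjoint_GamP [fS fs]; apply/indepP => g h.
rewrite !inE => /orP[/eqP->|gS] /orP[/eqP->|hS]; first by rewrite eqxx.
- by rewrite fs.
- by rewrite simC fs.
- exact: Si.
Qed.

Lemma indep1 f : indep sim [set f].
Proof. by apply/indepP => g h /set1P-> /set1P->; rewrite eqxx. Qed.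

Lemma chain_cons S J : J != [::] -> chain (S :: J) =
  [&& S \subset GamPS sim (head set0 J), indep sim S, head set0 J != set0 & chain J].
Proof. by case: J. Qed.

Lemma ins_cons f S J : J != [::] -> ins f (S :: J) =
  if [disjoint GamP sim f & head set0 J] then S :: ins f J else (f |: S) :: J.
Proof. by case: J. Qed.

Lemma chain_indep J : chain J -> all (indep sim) J.
Proof.
elim: J => [|S [|S' J] IH] //=; first by move/cards1P=> [f ->]; rewrite indep1.
by case/and4P=> _ -> _ /IH.
Qed.

Lemma size_ins f J : size (ins f J) = size J.
Proof. by elim: J => [|S [|S' J] IH] //=; case: ifP => //= _; rewrite IH. Qed.

(** [f] commutes with all sets before the first one it affects, so it is absorbed just before that
    one without change. If it affects none, it moves to the end, where A_f 1 is at most 1. *)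
Lemma weight_ins f J : all (indep sim) J ->
  [disjoint GamP sim f & head set0 J] ->
  forall s, act f (weight J) s <= weight (ins f J) s.
Proof.
elim: J => [_ _ s|S J IH /= /andP[Si Ji] fS s]; first exact: act1_le.
have [fS0 fSs] := disjoint_GamP f S fS.
have -> : act f (actS S (weight J)) s = actS S (act f (weight J)) s.
  by apply: act_actsC => g; rewrite mem_enum; apply: fSs.
case: J Ji IH => [|S' J] Ji IH.
  by apply: acts_le => {}s; exact: act1_le.
case: ifP => fS'; first by apply: acts_le; exact: IH.
rewrite [leRHS]/= (actS_setU1 _ fS0); last exact: indep_setU1.
rewrite /actS (act_actsC (f := f)) // => g; rewrite mem_enum; exact: fSs.
Qed.

(* The position where [f] was inserted can be read off the result: it is the
first set that [f] affects. *)
Lemma ins_inj f J1 J2 : [disjoint GamP sim f & head set0 J1] ->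
  [disjoint GamP sim f & head set0 J2] -> ins f J1 = ins f J2 -> J1 = J2.
Proof.
elim: J1 J2 => [|S1 J1 IH] [|S2 J2] d1 d2 E; have := congr1 size E;
  rewrite !size_ins //= => -[];
  move: d1 d2 E => /= /disjoint_GamP[fS1 _] /disjoint_GamP[fS2 _].
case: J1 J2 IH => [|S1' J1] [|S2' J2] IH // + _.
case: ifP => d1; case: ifP => d2.
- by case=> -> /(IH (S2' :: J2) d1 d2) ->.
- by case=> E; rewrite E setU11 in fS1.
- by case=> E; rewrite -E setU11 in fS2.
- by case=> E -> ->; rewrite -(setU1K fS1) E setU1K.
Qed.

Lemma head_ins f J :
  (head set0 J \subset head set0 (ins f J)) *
  (head set0 (ins f J) \subset f |: head set0 J).
Proof.
by case: J => [|S [|S' J]] /=; rewrite ?subsetUr ?sub0set //; case: ifP;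
  rewrite /= ?subsetUr ?subxx.
Qed.

Lemma GamPSS (S T : {set F}) : S \subset T -> GamPS sim S \subset GamPS sim T.
Proof.
move=> ST; apply/bigcupsP => f fS; apply: (bigcup_max f) => //.
exact: (subsetP ST).
Qed.

Lemma mem_GamPS f (S : {set F}) :
  (f \in GamPS sim S) = ~~ [disjoint GamP sim f & S].
Proof.
apply/idP/idP.
  case/bigcupP=> g gS; rewrite !inE => H.
  apply/negP => /disjoint_GamP [fS /(_ g gS)]; move/orP: H => [/eqP E|].
    by rewrite E gS in fS.
  by rewrite simC => ->.
apply: contraR => H; apply/disjoint_GamP; split=> [|g gS].
  apply: contra H => fS; apply/bigcupP; exists f => //; exact: setU11.
apply: contra H => fg; apply/bigcupP; exists g => //.
by rewrite !inE simC fg orbT.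
Qed.

Lemma GamPS0 : GamPS sim set0 = set0.
Proof. by rewrite /GamPS big_set0. Qed.

Lemma GamPSU1 f (S : {set F}) : GamPS sim (f |: S) = GamP sim f :|: GamPS sim S.
Proof. by rewrite /GamPS bigcup_setU big_set1. Qed.

(** Sets only grow under insertion, so the set before the enlarged one stays in its neighbourhood;
    and [f] joins a set only if it affects the next one. *)
Lemma chain_ins f J : chain J -> [disjoint GamP sim f & head set0 J] ->
  chain (ins f J).
Proof.
elim: J => // S [|S' J] // IH /and4P[SS' Si S'0 cJ] fS.
rewrite ins_cons //; case: ifP => fS'.
  have [sub _] := head_ins f (S' :: J).
  rewrite chain_cons; last by rewrite -size_eq0 size_ins.
  rewrite Si (IH cJ fS') (subset_trans SS' (GamPSS sub)) /= andbT.
  by apply: contra S'0 => /eqP E; rewrite E subset0 in sub.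
have fG : f \in GamPS sim S' by rewrite mem_GamPS fS'.
by apply/and4P; split=> //; rewrite ?subUset ?sub1set ?fG //; exact: indep_setU1.
Qed.

(** * Pasts that a run can still produce *)

(* The causal pasts that the rest of a run can still produce from [s] when [I] is
the set of the current round. The last clause makes the past reach back to the
current round: either the rest of the round contributes to it, or a flaw that is
already in [I] affects its next set. *)
Definition target (s : Omega) (I : {set F}) (J : seq {set F}) : bool :=
  [&& chain J, head set0 J \subset flaws_at fl s :\: GamPS sim I
    & (head set0 J != set0) || (nth set0 J 1 :&: GamPS sim I != set0)].

Definition targets_weight (d : nat) (s : Omega) (I : {set F}) : R :=
  \sum_(J : d.-tuple {set F} | target s I J) weight J s.

(** The flaws in the head of [J] lie outside Gamma^+(f), so by causality they were present before
    [f] was addressed. *)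
Lemma target_ins f s s' I J : potential_causality fl rho sim ->
  f \in flaws_at fl s :\: GamPS sim I -> step s f s' -> (1 < size J)%N ->
  target s' (f |: I) J ->
  [disjoint GamP sim f & head set0 J] /\ target s I (ins f J).
Proof.
move=> caus fs st sJ /and3P[cJ hJ tJ].
have dJ : [disjoint GamP sim f & head set0 J].
  apply/disjoint_GamP; split=> [|g].
    by apply/negP => /(subsetP hJ); rewrite !inE GamPSU1 !inE eqxx.
  by move/(subsetP hJ); rewrite inE GamPSU1 !inE !negb_or -!andbA => /and4P[_].
split=> //; apply/and3P; split; first exact: chain_ins.
  apply: subset_trans (head_ins f J).2 _; rewrite subUset sub1set fs /=.
  apply/subsetP => g /(subsetP hJ).
  rewrite inE GamPSU1 in_setU in_setU1 !negb_or inE.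
  move=> /andP[/andP[/andP[gf gG] gI] gs'].
  rewrite inE gI; have /subsetP/(_ g gs') := caus _ _ _ st.
  by rewrite in_setU in_setD1 [g \in Gam _ _]inE (negPf gG) orbF => /andP[].
case: J sJ cJ {hJ} tJ dJ => [|S [|S' J]] // _ cJ tJ dJ; rewrite ins_cons //.
case/orP: tJ => [S0|/set0Pn[g]].
  by apply/orP; left; case: ifP => //= _; apply/set0Pn; exists f; rewrite setU11.
rewrite inE GamPSU1 in_setU => /andP[gS' gfI].
case: ifP => fS'; last by apply/orP; left; apply/set0Pn; exists f; rewrite /= setU11.
(* Here [f] stays out of the head because it does not affect [S']; so the contact of [S'] with
   [f |: I], witnessed by [g], comes from [I]. *)
apply/orP; right => /=; apply/set0Pn; exists g.
have gI : g \in GamPS sim I.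
  case/orP: gfI => // gf; have := disjointFr fS' gf; by rewrite gS'.
have := (head_ins f (S' :: J)).1; rewrite -nth0 => /subsetP/(_ g gS').
by rewrite inE gI andbT nth0.
Qed.

Lemma targets_weight_ge0 d s I : 0 <= targets_weight d s I.
Proof. by apply: sumr_ge0 => J _; exact: weight_ge0. Qed.

Lemma ins_tupleP f d (J : d.-tuple {set F}) : size (ins f J) == d.
Proof. by rewrite size_ins size_tuple. Qed.

(** For each [J], the successors of [s] at which [J] is a target contribute at most
    [act f (weight J) s], hence at most the weight of [ins f J]. Since the rule fixes [f] at this
    point of the run, one injective map [ins f] serves all these pasts. *)
Lemma targets_weight_step f d s I : potential_causality fl rho sim ->
  f \in flaws_at fl s :\: GamPS sim I -> (1 < d)%N ->
  act f (fun s' => targets_weight d s' (f |: I)) s <= targets_weight d s I.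
Proof.
move=> caus fs d1; rewrite /act.
under eq_bigr => s' _ do rewrite mulr_sumr big_mkcond.
rewrite exchange_big /=.
pose P (J : d.-tuple {set F}) :=
  [exists s', step s f s' && target s' (f |: I) J].
have PP (J : d.-tuple {set F}) : P J -> [/\ chain J,
    [disjoint GamP sim f & head set0 J] & target s I (ins f J)].
  case/existsP=> s' /andP[st tJ].
  have [|a b] := target_ins caus fs st _ tJ; first by rewrite size_tuple.
  by split=> //; case/and3P: tJ.
apply: (@le_trans _ _ (\sum_(J : d.-tuple {set F} | P J) act f (weight J) s)).
  rewrite [leRHS]big_mkcond; apply: ler_sum => J _; case: ifPn => PJ.
    apply: ler_sum => s' st; case: ifP => // _.
    by rewrite mulr_ge0 ?weight_ge0 // step_rho_ge0.
  rewrite big1 // => s' st; case: ifP => // tJ.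
  by case/negP: PJ; apply/existsP; exists s'; rewrite st.
apply: (@ler_sum_inj _ _ _ _ _ (fun J => Tuple (ins_tupleP f J))).
- move=> J1 J2 /PP[_ a _] /PP[_ b _] /(congr1 val) /= /(ins_inj a b).
  exact: val_inj.
- by move=> J /PP[].
- move=> J /PP[cJ dJ _]; apply: weight_ins => //; exact: chain_indep.
- by move=> J _; exact: weight_ge0.
Qed.

(** When a round ends, pasts are padded with [set0]. The old head is nonempty and made of present
    flaws, all in Gamma^+(I), which gives the contact with [I] required by [target]. *)
Lemma targets_weight_round d s I : flaws_at fl s \subset GamPS sim I ->
  targets_weight d s set0 <= targets_weight d.+1 s I.
Proof.
move=> sub; apply: (@ler_sum_inj _ _ _ _ _ (fun J => cons_tuple set0 J)).
- move=> J1 J2 _ _ /(congr1 val) [] ; exact: val_inj.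
- move=> J tJ _; move: tJ; rewrite /target GamPS0 setI0 eqxx orbF setD0 /=.
  case: J => [[|S J] szJ] // /and3P[cJ sJ S0] /=.
  have /setIidPl -> : S \subset GamPS sim I by apply: subset_trans sub.
  rewrite !sub0set ?eqxx /=; apply/andP; split=> //; apply/and3P; split=> //.
  by apply/indepP => f; rewrite inE.
- by move=> J _; rewrite /= actS0.
- by move=> J _; exact: weight_ge0.
Qed.

(** For any present flaw [f], the past consisting of [[set f]] alone has weight 1. *)
Lemma targets_weight_last s : flaws_at fl s != set0 ->
  1 <= targets_weight 1 s set0.
Proof.
case/set0Pn=> f fs; rewrite /targets_weight (bigD1 [tuple [set f]]) /=; last first.
  rewrite /target GamPS0 setD0 /= cards1 sub1set fs /=.
  by apply/orP; left; apply/set0Pn; exists f; rewrite inE.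
rewrite actS1 act1; last by rewrite inE in fs.
by rewrite lerDl sumr_ge0 // => J _; exact: weight_ge0.
Qed.

(** * Failure probability of a run with a fixed picking rule *)

Section Run.
Variables (strat : strategy Omega F) (ok : nat -> bool).
Hypothesis stratP : valid_strategy fl sim strat.

Local Notation run := (run fl rho sim strat ok).

(** With [round_count], names the values [J] and [k'] that [run] computes internally. *)
Definition round_set (s : Omega) (oI : option {set F}) : {set F} :=
  if avail fl sim s oI == set0 then set0 else odflt set0 oI.

Definition round_count (s : Omega) (oI : option {set F}) (k : nat) : nat :=
  if avail fl sim s oI == set0 then k.+1 else k.

Lemma run_stop n s0 h s oI k : (avail fl sim s oI == set0) && flawless fl s ->
  run n s0 h s oI k = (ok k)%:R.
Proof. by case: n => [|n] /= ->; case: (ok k). Qed.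

Lemma run_continue n s0 h s oI k :
  ~~ ((avail fl sim s oI == set0) && flawless fl s) ->
  let f := strat s0 h s (round_set s oI) in
  f \in flaws_at fl s :\: GamPS sim (round_set s oI) /\
  run n.+1 s0 h s oI k =
    \sum_s' rho f s s' * run n s0 (rcons h (f, s')) s'
      (Some (f |: round_set s oI)) (round_count s oI k).
Proof.
move=> ns f; split; last by rewrite /= (negPf ns).
apply: stratP; move: ns; rewrite /round_set; case: eqP => [_ /=|].
  by rewrite GamPS0 setD0.
by case: oI {f} => [I|] //= /eqP.
Qed.

Lemma run_bounds n s0 h s oI k : 0 <= run n s0 h s oI k <= 1.
Proof.
elim: n h s oI k => [|n IH] h s oI k;
  (case: (boolP ((avail fl sim s oI == set0) && flawless fl s)) => E;
    first by rewrite run_stop //; case: (ok k); rewrite ?lexx ler01).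
  by rewrite /= (negPf E) lexx ler01.
have [] := run_continue n s0 h k E; set f := strat _ _ _ _.
rewrite inE => /andP[_]; rewrite inE => sf ->.
have [rho0 rho1] := rhoP sf.
have IHs s' :=
  IH (rcons h (f, s')) s' (Some (f |: round_set s oI)) (round_count s oI k).
apply/andP; split.
  by apply: sumr_ge0 => s' _; rewrite mulr_ge0 ?rho0 //; case/andP: (IHs s').
rewrite -rho1; apply: ler_sum => s' _; rewrite ler_piMr ?rho0 //.
by case/andP: (IHs s').
Qed.

Variable m : nat.
Hypothesis okP : forall k, (k < m)%N -> ok k.
Hypothesis caus : potential_causality fl rho sim.

Lemma fail_step n s0 h s I k f :
  (forall s' h', 1 - run n s0 h' s' (Some (f |: I)) k <=
                 targets_weight (m - k).+1 s' (f |: I)) ->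
  f \in flaws_at fl s :\: GamPS sim I -> (k < m)%N ->
  1 - \sum_s' rho f s s' * run n s0 (rcons h (f, s')) s' (Some (f |: I)) k <=
    targets_weight (m - k).+1 s I.
Proof.
move=> IH fs km.
apply: le_trans (targets_weight_step caus fs _); last by rewrite ltnS subn_gt0.
have sf : s \in fl f by move: fs; rewrite !inE => /andP[].
have [_ <-] := rhoP sf; rewrite -sumrB.
under eq_bigr => s' _ do rewrite -[X in X - _]mulr1 -mulrBr.
by rewrite rho_sum_step //; apply: act_le.
Qed.

(** Inside round [k] the past has one set for each of the rounds [k] to [m]; between rounds it
    starts with round [k.+1]. *)
Definition fail_bound (s : Omega) (oI : option {set F}) (k : nat) : R :=
  if oI is Some A then targets_weight (m - k).+1 s A
  else targets_weight (m - k) s set0.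

(* A round addresses each flaw at most once, so this many steps suffice to reach
round [m] or to stop before. *)
Definition fuel (oI : option {set F}) (k : nat) : nat :=
  (m.-1 - k) * #|F| + (if oI is Some A then #|~: A| else 0).

Lemma fail_bound_ge0 s oI k : 0 <= fail_bound s oI k.
Proof. by case: oI => [I|]; exact: targets_weight_ge0. Qed.

Lemma fail_bound_round s oI k : avail fl sim s oI = set0 ->
  targets_weight (m - k) s set0 <= fail_bound s oI k.
Proof.
case: oI => [I|] //= A0; apply: targets_weight_round.
by rewrite -setD_eq0 A0.
Qed.

Lemma fail_bound_last s oI k : avail fl sim s oI = set0 -> ~~ flawless fl s ->
  k.+1 = m -> 1 <= fail_bound s oI k.
Proof.
move=> A0 ns km; apply: le_trans (fail_bound_round k A0).
by rewrite -km subSnn; exact: targets_weight_last.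
Qed.

(** Without fuel, round [m.-1] is the last one started and its set, if any, is all of [F]; so the
    next step opens round [m]. *)
Lemma fuel0 s oI k : (k < m)%N -> fuel oI k = 0 ->
  ~~ ((avail fl sim s oI == set0) && flawless fl s) ->
  avail fl sim s oI = set0 /\ k.+1 = m.
Proof.
move=> km /eqP; rewrite addn_eq0 muln_eq0 => /andP[F0 I0] ns.
have {ns} [f fs] : exists f, f \in if avail fl sim s oI == set0 then flaws_at fl s
    else avail fl sim s oI.
  by apply/set0Pn; move: ns; case: ifP => //= ->.
split.
  move: fs; case: ifP => [/eqP //|_]; case: oI I0 => [I|] //= I0.
  rewrite inE mem_GamPS negbK => /andP[/disjoint_GamP[fI _] _].
  by move: I0; rewrite cards_eq0 => /eqP/setP/(_ f); rewrite !inE fI.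
have F1 : #|F| != 0 by rewrite -lt0n; apply/card_gt0P; exists f.
move: F0; rewrite (negPf F1) orbF subn_eq0 => mk.
by apply/eqP; rewrite eqn_leq km -ltnS; case: (m) km mk.
Qed.

(** Along the run [fail_bound] behaves as a supermartingale, and it is at least 1 when round [m] is
    about to begin. *)
Lemma run_fail_le n s0 h s oI k : (k < m)%N -> (fuel oI k <= n)%N ->
  1 - run n s0 h s oI k <= fail_bound s oI k.
Proof.
elim: n h s oI k => [|n IH] h s oI k km kn;
  (case: (boolP ((avail fl sim s oI == set0) && flawless fl s)) => E;
    first by rewrite run_stop // okP // subrr fail_bound_ge0).
  have [|A0 km1] := fuel0 km _ E; first by apply/eqP; rewrite -leqn0.
  rewrite lerBlDr (le_trans (fail_bound_last A0 _ km1)) //.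
    by move: E; rewrite A0 eqxx.
  by rewrite lerDl; case/andP: (run_bounds 0 s0 h s oI k).
have [] := run_continue n s0 h k E; rewrite /round_count /round_set => fs ->.
move: fs; case: ifPn => A0; set f := strat _ _ _ _ => fs.
  have [km1|km1] := eqVneq k.+1 m.
    rewrite lerBlDr (le_trans (fail_bound_last (eqP A0) _ km1)) //.
      by move: E; rewrite A0.
    rewrite lerDl.
    move: fs; rewrite !inE => /andP[_] /rhoP [rho0 _].
    apply: sumr_ge0 => s' _; rewrite mulr_ge0 ?rho0 //.
    by case/andP: (run_bounds n s0 (rcons h (f, s')) s' (Some (f |: set0)) k.+1).
  have km2 : (k.+1 < m)%N by rewrite ltn_neqAle km1.
  apply: le_trans (fail_bound_round k (eqP A0)).
  have -> : (m - k = (m - k.+1).+1)%N by rewrite subnSK.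
  apply: fail_step => // s' h'; apply: (IH h' s' (Some _)) => //.
  rewrite -ltnS; apply: leq_trans kn; rewrite /fuel.
  (* Opening a round trades [#|F|] units of fuel for the [#|F| - 1] units left once [f] is in the
     new set. *)
  have -> : (m.-1 - k = (m.-1 - k.+1).+1)%N.
    by rewrite subnSK //; case: (m) km2.
  rewrite mulSn (addnC #|F|) -addnA ltn_add2l ltn_addr //.
  by rewrite -(cardsC (f |: set0)) setU0 cards1.
case: oI kn A0 {E} @f fs => [I|] kn A0 f fs; last by rewrite eqxx in A0.
apply: fail_step => // s' h'; apply: (IH h' s' (Some _)) => //.
rewrite -ltnS; apply: leq_trans kn; rewrite /fuel -addnS leq_add2l.
have fI : f \notin I.
  by move: fs; rewrite inE mem_GamPS negbK => /andP[/disjoint_GamP[]].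
by rewrite setCU setIC -setDE [X in (_ < X)%N](cardsD1 f) inE fI.
Qed.

End Run.

(** * Pasts of nonzero weight *)

Definition GamS (S : {set F}) : {set F} := \bigcup_(f in S) Gam sim f.

Lemma GamS_sub S : GamS S \subset GamPS sim S.
Proof.
by apply/bigcupsP => f fS; apply: (bigcup_max f) => //; exact: subsetUr.
Qed.

(** [chain] only places each set in Gamma^+ of the next one, whereas the algorithmic LLL condition
    sums over subsets of Gamma; hence this sharper inclusion. *)
Definition tight (J : seq {set F}) : bool :=
  sorted (fun A B : {set F} => A \subset GamS B) J.

(* A flaw [f] of two consecutive sets that is unrelated to the second one makes
[act f] occur twice in a row, and [f] cannot survive its own resampling. *)
Lemma weight_not_tight J : potential_causality fl rho sim -> chain J ->
  ~~ tight J -> weight J =1 fun=> 0.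
Proof.
move=> caus; elim: J => [|S [|S' J] IH] //.
move=> cJ; have Ji := chain_indep cJ; move: cJ => /and4P[SS' _ _ cJ].
rewrite /tight /= negb_and => H s; case/orP: H => [|/(IH cJ) w0]; last first.
  by rewrite -[RHS](acts0 (enum S) s); exact: eq_acts.
case/subsetPn=> f fS; have /bigcupP[g gS'] := subsetP SS' f fS.
move: Ji => /and3P[Si S'i _].
rewrite in_setU1 => /orP[/eqP fg|fg] nf; last by case/negP: nf; apply/bigcupP; exists g.
subst g; rewrite /= (actS_actS0 (f := f)) //.
by apply: contra nf => ff; apply/bigcupP; exists f; rewrite ?inE.
Qed.

(** * Averaging over [omega] *)

Section Charge.
Variables (omega : Omega -> R) (lam : F -> R).
Hypothesis omegaP : pos_distr omega.
Hypothesis lamP : cond_i fl rho omega lam.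
Hypothesis flP : flaws_ok fl.

(** Some [s] in [f] has a successor [s'] of positive probability, and the term of [s] in condition
    (i) at [s'] is positive. *)
Lemma lam_gt0 f : 0 < lam f.
Proof.
have [omega0 _] := omegaP; have /set0Pn[s sf] := flP.2 f.
have [rho0 rho1] := rhoP sf.
have [|s' /andP[_ r0]] := @psumr_neq0P _ _ xpredT (rho f s) (fun s' _ => rho0 s').
  by rewrite rho1; apply/eqP; exact: oner_neq0.
have st : step s f s' by rewrite /Defs.step sf inE gt_eqF.
apply: lt_le_trans (lamP f s'); rewrite (bigD1 s) //= ltr_wpDr //.
  apply: sumr_ge0 => t /andP[/step_rho_ge0 a _].
  by rewrite divr_ge0 ?(mulr_ge0 a) // ltW.
by rewrite divr_gt0 ?mulr_gt0.
Qed.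

Definition lamS (S : {set F}) : R := \prod_(f in S) lam f.

Definition charge (J : seq {set F}) : R := \prod_(S <- J) lamS S.

Lemma lamS_ge0 S : 0 <= lamS S.
Proof. by apply: prodr_ge0 => f _; rewrite ltW ?lam_gt0. Qed.

Lemma charge_ge0 J : 0 <= charge J.
Proof. by apply: prodr_ge0 => S _; exact: lamS_ge0. Qed.

(** After exchanging the sums, this is condition (i) multiplied by [omega s' * u s']. *)
Lemma sum_act f u : (forall s, 0 <= u s) ->
  \sum_s omega s * act f u s <= lam f * \sum_s omega s * u s.
Proof.
move=> u0; have [omega0 _] := omegaP; rewrite mulr_sumr /act.
under eq_bigr => s _ do rewrite mulr_sumr big_mkcond.
rewrite exchange_big /=; apply: ler_sum => s' _; rewrite -big_mkcond /=.
apply: le_trans (ler_wpM2r _ (lamP f s')); last by rewrite mulr_ge0 // ltW.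
rewrite mulr_suml; apply: ler_sum => s _.
by rewrite -!mulrA [_^-1 * _]mulrA mulVf ?gt_eqF // mul1r mulrCA.
Qed.

Lemma sum_acts l u : (forall s, 0 <= u s) ->
  \sum_s omega s * acts l u s <= \prod_(f <- l) lam f * \sum_s omega s * u s.
Proof.
move=> u0; elim: l => [|f l IH]; first by rewrite big_nil mul1r.
rewrite big_cons -mulrA; apply: le_trans (ler_wpM2l (ltW (lam_gt0 f)) IH).
by apply: sum_act; exact: acts_ge0.
Qed.

Lemma sum_weight J : \sum_s omega s * weight J s <= charge J.
Proof.
have [_ omega1] := omegaP; rewrite /charge; elim: J => [|S J IH].
  by rewrite big_nil -[leRHS]omega1; apply: ler_sum => s _; rewrite mulr1.
rewrite big_cons; apply: le_trans (ler_wpM2l (lamS_ge0 S) IH).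
by apply: le_trans (sum_acts _ (weight_ge0 J)) _; rewrite big_enum.
Qed.

(** * Geometric decay in the number of rounds *)

Section Decay.
(** Common form of the two conditions: [mh S] will be the product of [mu] over [S] for the
    algorithmic LLL condition, and q_S(p)/q_0(p), with q_0 for the empty set, for Shearer's. *)
Variables (theta : R) (mh : {set F} -> R).
Hypothesis theta0 : 0 <= theta.
Hypothesis mh_ge0 : forall S, 0 <= mh S.
Hypothesis mh0 : mh set0 = 1.
Hypothesis mhP : forall S, indep sim S -> S != set0 ->
  lamS S * (\sum_(A : {set F} | (A \subset GamS S) && indep sim A) mh A) <=
  theta * mh S.

Lemma indep0 : indep sim set0.
Proof. by apply/indepP => f; rewrite inE. Qed.

Lemma lamS_le S : indep sim S -> S != set0 -> lamS S <= theta * mh S.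
Proof.
move=> Si S0; apply: le_trans (mhP Si S0); rewrite ler_peMr ?lamS_ge0 //.
rewrite (bigD1 set0) ?sub0set ?indep0 //= mh0 lerDl.
by apply: sumr_ge0.
Qed.

(** The head carries [mh] instead of [lamS]. Summing over the head with the rest [J] fixed, [mhP]
    turns the factor [lamS] of the next set into [theta] times its [mh], which is the same form for
    [J]. *)
Lemma sum_chain_le d :
  \sum_(J : d.+1.-tuple {set F} | chain J && tight J)
     mh (head set0 J) * charge (behead J) <= theta ^+ d * \sum_f mh [set f].
Proof.
elim: d => [|d IH].
  rewrite expr0 mul1r; apply: (@le_trans _ _ (\sum_(J in [set [tuple [set f]] | f : F])
     mh (head set0 (tval J)))); last first.
    rewrite big_imset //= => f g _ _ /(congr1 val) [] /setP/(_ f).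
    by rewrite !inE eqxx => /esym/eqP.
  rewrite le_eqVlt; apply/orP; left; apply/eqP; apply: eq_big => [J|J _].
    case/tupleP: J => S J; rewrite (tuple0 J) /= andbT.
    apply/cards1P/imsetP => [[f ->]|[f _ /(congr1 val) [->]]]; exists f => //.
  by case/tupleP: J => S J; rewrite (tuple0 J) /charge big_nil mulr1.
rewrite big_mkcond big_tuple_cons exprS -mulrA.
apply: le_trans (ler_wpM2l theta0 IH); rewrite mulr_sumr [leRHS]big_mkcond.
apply: ler_sum => J _ /=.
case: ifPn => [/andP[cJ tJ]|nJ]; last first.
  rewrite big1 // => S _; case: ifP => // /andP[cSJ /path_sorted tJ].
  have : chain (S :: J) by exact: cSJ.
  rewrite chain_cons; last by case/tupleP: J {nJ cSJ tJ}.
  by move=> /and4P[_ _ _ cJ]; case/negP: nJ; rewrite cJ.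
(* Nothing extends a [J] with empty head: [chain] allows only its first set to be empty. *)
have [h0|h0] := eqVneq (head set0 J) set0.
  rewrite big1 ?mulr_ge0 ?charge_ge0 // => S _; case: ifP => // /andP[cSJ _].
  have : chain (S :: J) by exact: cSJ.
  rewrite chain_cons; first by rewrite h0 eqxx !andbF.
  by case/tupleP: J {cJ tJ h0 cSJ}.
rewrite -big_mkcond /= -mulr_suml.
have hi : indep sim (head set0 J).
  by case/tupleP: J cJ {tJ h0} => S J /chain_indep /andP[].
have -> : charge J = lamS (head set0 J) * charge (behead J).
  by case/tupleP: J {cJ tJ h0 hi} => S J; rewrite /charge big_cons.
rewrite !mulrA ler_wpM2r ?charge_ge0 // mulrC.
apply: le_trans (mhP hi h0); rewrite ler_wpM2l ?lamS_ge0 //.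
rewrite le_eqVlt; apply/orP; left; apply/eqP; apply: eq_bigl => S.
case/tupleP: J cJ tJ h0 {hi} => S' J; rewrite [head _ _]/= => cJ tJ h0.
apply/andP/andP => [[/and4P[_ Si _ _] /andP[SS' _]] //|[SS' Si]].
split; last by apply/andP; split.
apply/and4P; split=> //; exact: subset_trans SS' (GamS_sub S').
Qed.

(** The factor of [theta] beyond [sum_chain_le] comes from the head, whose [lamS] is at most
    [theta * mh]. This needs a nonempty head, which [target] forces when the round set is empty. *)
Lemma sum_targets_le d : potential_causality fl rho sim ->
  \sum_s omega s * targets_weight d.+1 s set0 <=
    theta ^+ d.+1 * \sum_f mh [set f].
Proof.
move=> caus; have [omega0 _] := omegaP.
rewrite exprS -mulrA; apply: le_trans (ler_wpM2l theta0 (sum_chain_le d)).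
rewrite mulr_sumr.
under eq_bigr => s _ do rewrite mulr_sumr big_mkcond.
rewrite exchange_big [leRHS]big_mkcond /=; apply: ler_sum => J _.
have [cJ|ncJ] := boolP (chain J); last first.
  by rewrite big1 // => s _; rewrite /target (negPf ncJ).
have [tJ|ntJ] := boolP (tight J); last first.
  by rewrite big1 // => s _; rewrite weight_not_tight // mulr0 if_same.
have [h0|h0] := eqVneq (head set0 J) set0.
  rewrite big1 ?mulr_ge0 ?charge_ge0 // => s _.
  by rewrite /target h0 GamPS0 setI0 eqxx !andbF.
apply: (@le_trans _ _ (\sum_s omega s * weight J s)).
  by apply: ler_sum => s _; case: ifP => // _; rewrite mulr_ge0 ?weight_ge0 ?ltW.
apply: le_trans (sum_weight J) _.
case/tupleP: J cJ h0 {tJ} => S J /chain_indep /andP[Si _] S0.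
by rewrite /charge big_cons mulrA ler_wpM2r ?charge_ge0 // lamS_le.
Qed.

End Decay.

(** * Decay under the algorithmic LLL condition *)

Section LLL.
Variables (theta : R) (mu : F -> R).
Hypothesis theta01 : 0 <= theta <= 1.
Hypothesis mu_gt0 : forall f, 0 < mu f.
Hypothesis mu_lam : forall f, lam f / mu f *
  (\sum_(S : {set F} | (S \subset Gam sim f) && indep sim S) \prod_(g in S) mu g)
  <= theta.

Definition indep_sum (U : {set F}) : R :=
  \sum_(S : {set F} | (S \subset U) && indep sim S) \prod_(g in S) mu g.

Lemma muS_ge0 (S : {set F}) : 0 <= \prod_(g in S) mu g.
Proof. by apply: prodr_ge0 => f _; rewrite ltW. Qed.

Lemma indepS (S T : {set F}) : S \subset T -> indep sim T -> indep sim S.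
Proof.
move=> /subsetP ST /indepP Ti; apply/indepP => f g /ST fT /ST gT; exact: Ti.
Qed.

(** An independent subset of the union is determined by its parts inside and outside [U], which are
    independent, and its product of [mu] factors accordingly. *)
Lemma indep_sum_setU U V : indep_sum (U :|: V) <= indep_sum U * indep_sum V.
Proof.
rewrite /indep_sum mulr_suml.
under [leRHS]eq_bigr => S _ do rewrite mulr_sumr.
rewrite pair_big /=.
apply: (@ler_sum_inj _ _ _ _ _ (fun S : {set F} => (S :&: U, S :\: U))).
- by move=> S T _ _ [E1 E2]; rewrite -(setID S U) E1 E2 setID.
- move=> S /andP[SUV Si] _; rewrite subsetIr subDset SUV.
  by rewrite !(indepS _ Si) ?subsetIl ?subsetDl.
- by move=> S _; rewrite (big_setID U).
- by move=> [S T] _; rewrite mulr_ge0 ?muS_ge0.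
Qed.

(** Condition (ii) multiplied over the list, with [indep_sum_setU] splitting the union of
    neighbourhoods. *)
Lemma lam_indep_sum_seq l :
  \prod_(f <- l) lam f * indep_sum (\bigcup_(f <- l) Gam sim f) <=
  theta ^+ size l * \prod_(f <- l) mu f.
Proof.
elim: l => [|f l IH].
  rewrite !big_nil expr0 !mul1r /indep_sum (big_pred1 set0) ?big_set0 // => S.
  by rewrite subset0 /=; case: eqVneq => [->|_] /=; rewrite ?indep0 ?eqxx.
rewrite !big_cons exprS.
have H : lam f * indep_sum (Gam sim f) <= theta * mu f.
  by rewrite -ler_pdivrMr // mulrAC mu_lam.
have sum0 U : 0 <= indep_sum U by apply: sumr_ge0 => S _; exact: muS_ge0.
apply: le_trans (ler_wpM2l _ (indep_sum_setU _ _)) _.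
  by rewrite mulr_ge0 ?prodr_ge0 // => *; rewrite ltW ?lam_gt0.
rewrite mulrACA [leRHS]mulrACA; apply: ler_pM => //.
- by rewrite mulr_ge0 // ltW ?lam_gt0.
- by rewrite mulr_ge0 // prodr_ge0 // => *; rewrite ltW ?lam_gt0.
Qed.

Lemma expr_card_le (S : {set F}) : S != set0 -> theta ^+ #|S| <= theta.
Proof.
case/andP: theta01 => t0 t1; rewrite -card_gt0; case: #|S| => // n _.
by rewrite exprS ler_piMr // exprn_ile1.
Qed.

Lemma lll_decay (S : {set F}) : S != set0 ->
  lamS S * indep_sum (GamS S) <= theta * \prod_(f in S) mu f.
Proof.
move=> S0; have := lam_indep_sum_seq (enum S).
rewrite -cardE !big_enum => H; apply: le_trans H _.
by rewrite ler_wpM2r ?muS_ge0 ?expr_card_le.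
Qed.

End LLL.

(** * Decay under Shearer's condition *)

Section Shearer.
Variables (theta : R) (p : F -> R).
Hypothesis theta01 : 0 < theta <= 1.
Hypothesis q_ge0 : forall S, 0 <= qS sim p S.
Hypothesis lam_p : forall f, lam f <= theta * p f.

Lemma p_gt0 f : 0 < p f.
Proof.
have := lt_le_trans (lam_gt0 f) (lam_p f).
by case/andP: theta01 => t0 _; rewrite pmulr_rgt0.
Qed.

(** After exchanging the sums, the coefficient of [J] contains the alternating sum over the subsets
    of [J :&: U], which vanishes unless this set is empty. *)
Lemma sum_qS (U : {set F}) : \sum_(S : {set F} | S \subset U) qS sim p S =
  \sum_(J : {set F} | indep sim J && (J :&: U == set0))
    (-1) ^+ #|J| * \prod_(f in J) p f.
Proof.
pose P (J : {set F}) := \prod_(f in J) p f.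
rewrite /qS (exchange_big_dep (indep sim)) /=; last by move=> S J _ /andP[].
rewrite big_mkcondr /=; apply: eq_bigr => J Ji; rewrite Ji /=.
transitivity ((-1) ^+ #|J| * P J * \sum_(S : {set F} | S \subset J :&: U) (-1) ^+ #|S|).
  rewrite mulr_sumr; apply: eq_big => [S|S /andP[_ SJ]].
    by rewrite subsetI andbC.
  rewrite -/(P J) mulrAC; congr (_ * _); rewrite -signr_odd -[X in X * _]signr_odd.
  by rewrite -[X in _ * X]signr_odd -signr_addb oddB ?subset_leq_card.
by rewrite sum_sign_subset; case: eqP => _; rewrite ?mulr1 ?mulr0.
Qed.

Lemma sub_GamPS (S : {set F}) : S \subset GamPS sim S.
Proof.
by apply/subsetP => f fS; apply/bigcupP; exists f => //; exact: setU11.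
Qed.

(** The independent sets containing [S] are the [S :|: I] with [I] independent and disjoint from
    Gamma^+(S); the signed sum over these [I] is evaluated by [sum_qS]. *)
Lemma qS_indep S : indep sim S ->
  qS sim p S =
    \prod_(f in S) p f * \sum_(A : {set F} | A \subset GamPS sim S) qS sim p A.
Proof.
move=> Si; rewrite sum_qS mulr_sumr /qS.
rewrite (reindex_onto (fun I => S :|: I) (fun J => J :\: S)) /=; last first.
  move=> J /andP[_ SJ]; apply/setP => f; rewrite !inE.
  by case: (boolP (f \in S)) => //= /(subsetP SJ).
have disj (I : {set F}) : I :&: GamPS sim S == set0 -> [disjoint S & I].
  rewrite setI_eq0 => d; rewrite disjoint_sym.
  exact: disjointWr (sub_GamPS S) d.
apply: eq_big => [I|I /andP[/andP[_ _] /eqP E]].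
  rewrite subsetUl andbT; apply/andP/andP => [[SIi /eqP E]|[Ii IS]].
    split; first by apply: indepS SIi; exact: subsetUr.
    rewrite setI_eq0 disjoint_subset; apply/subsetP => f fI.
    rewrite inE mem_GamPS negbK; apply/disjoint_GamP; split=> [|g gS].
      by move: fI; rewrite -E inE => /andP[].
    apply: (indepP _ SIi); rewrite ?inE ?gS ?fI ?orbT //.
    by move: fI; rewrite -E !inE => /andP[fS _]; apply: contraNneq fS => ->.
  split; last first.
    by rewrite setDUl setDv set0U; apply/eqP/setDidPl; rewrite disjoint_sym disj.
  have H f g : f \in S -> g \in I -> ~~ sim f g.
    move=> fS gI; rewrite simC; move: IS; rewrite setI_eq0 => d.
    by have := disjointFr d gI; rewrite mem_GamPS => /negbFE /disjoint_GamP[_]; apply.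
  apply/indepP => f g; rewrite !inE => /orP[fS|fI] /orP[gS|gI] fg.
  - exact: (indepP _ Si).
  - exact: H.
  - by rewrite simC H.
  - exact: (indepP _ Ii).
have d : [disjoint S & I] by rewrite disjoint_sym -E disjoints_subset setDE subsetIr.
rewrite cardsU (disjoint_setI0 d) cards0 subn0 addKn mulrCA; congr (_ * _).
rewrite (big_setID S) E /=; congr (_ * _).
by have -> : (S :|: I) :&: S = S by apply/setIidPr; exact: subsetUl.
Qed.

(** By [qS_indep], it remains to enlarge [GamS S] to [GamPS sim S], which is harmless as all q are
    nonnegative, and to bound [lamS] by the product of the [theta * p f]. *)
Lemma shearer_decay (S : {set F}) : indep sim S -> S != set0 ->
  lamS S * (\sum_(A : {set F} | (A \subset GamS S) && indep sim A)
     (qS sim p A / qS sim p set0)) <= theta * (qS sim p S / qS sim p set0).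
Proof.
move=> Si S0; rewrite -mulr_suml !mulrA ler_wpM2r ?invr_ge0 //.
rewrite (qS_indep Si) mulrA; apply: ler_pM.
- exact: lamS_ge0.
- exact: sumr_ge0.
- have t01 : 0 <= theta <= 1 by case/andP: theta01 => /ltW -> ->.
  apply: le_trans (ler_wpM2r _ (expr_card_le t01 S0)); last first.
    by apply: prodr_ge0 => f _; rewrite ltW ?p_gt0.
  rewrite /lamS -prodr_const -big_split /=; apply: ler_prod => f _.
  by rewrite lam_p ltW ?lam_gt0.
apply: (@ler_sum_inj _ _ _ _ _ id) => // A /andP[AS _] _.
exact: subset_trans AS (GamS_sub S).
Qed.

End Shearer.
End Charge.

End Commutation.
End Operators.

(** * From decay to the bound on the number of rounds *)

Lemma prob_terminates_ge (R : realType) (Omega F : finType)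
    (fl : F -> {set Omega}) (rho : F -> Omega -> Omega -> R) (sim : rel F)
    (winit : Omega -> R) (strat : strategy Omega F) (ok : nat -> bool) (n : nat) :
  rho_distr fl rho -> valid_strategy fl sim strat -> distr winit ->
  \sum_s winit s * run fl rho sim strat ok n s [::] s None 0 <=
    prob_terminates fl rho sim winit strat ok.
Proof.
move=> rhoP stratP [winit0 winit1]; apply: ub_le_sup; last by exists n.
exists 1 => _ [k _ <-]; rewrite -winit1; apply: ler_sum => s _.
by rewrite ler_piMr //; case/andP: (run_bounds rhoP ok stratP k s [::] s None 0).
Qed.

(** The horizon [fuel] already gives the bound, and [winit <= gamma * omega] reduces the initial
    distribution to [omega]. *)
Lemma prob_fail_le (R : realType) (Omega F : finType)
    (fl : F -> {set Omega}) (rho : F -> Omega -> Omega -> R) (sim : rel F)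
    (omega winit : Omega -> R) (lam : F -> R) (theta gamma : R)
    (mh : {set F} -> R) (strat : strategy Omega F) (ok : nat -> bool) (m : nat) :
  flaws_ok fl -> rho_distr fl rho -> pos_distr omega -> sym_rel sim ->
  potential_causality fl rho sim -> strongly_commutative fl rho sim ->
  cond_i fl rho omega lam -> distr winit -> valid_strategy fl sim strat ->
  0 <= theta -> (forall S, 0 <= mh S) -> mh set0 = 1 ->
  (forall S, indep sim S -> S != set0 ->
    lamS lam S * (\sum_(A : {set F} | (A \subset GamS sim S) && indep sim A) mh A) <=
    theta * mh S) ->
  0 <= gamma -> (forall s, winit s <= gamma * omega s) ->
  (0 < m)%N -> (forall k, (k < m)%N -> ok k) ->
  1 - prob_terminates fl rho sim winit strat ok <=
    gamma * (theta ^+ m * \sum_f mh [set f]).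
Proof.
move=> flP rhoP omegaP simC caus scomm lamP winitP stratP t0 mh_ge0 mh0 mhP.
move=> gamma0 wg m0 okP; have [winit0 winit1] := winitP.
apply: (@le_trans _ _ (1 - \sum_s winit s *
    run fl rho sim strat ok (fuel m (@None {set F}) 0) s [::] s None 0)).
  by rewrite lerB // prob_terminates_ge.
rewrite -[X in X - _]winit1 -sumrB.
have := sum_targets_le rhoP simC scomm omegaP lamP flP t0 mh_ge0 mh0 mhP m.-1 caus.
rewrite prednK // => H; apply: le_trans (ler_wpM2l gamma0 H).
rewrite mulr_sumr; apply: ler_sum => s _.
rewrite -[X in X - _]mulr1 -mulrBr mulrA.
have B := run_fail_le rhoP simC scomm stratP okP caus s [::] s m0
  (leqnn (fuel m None 0)).
apply: le_trans (ler_wpM2l (winit0 s) B) _.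
by rewrite /= subn0 ler_wpM2r ?targets_weight_ge0.
Qed.

Lemma powR_ln_div (R : realType) (theta c : R) : 0 < theta < 1 -> 0 < c ->
  theta `^ (ln c / ln theta^-1) = c^-1.
Proof.
move=> /andP[t0 t1] c0; apply: ln_inj; rewrite ?posrE ?powR_gt0 ?invr_gt0 //.
have lt0 : 0 < ln theta^-1 by rewrite ln_gt0 // invf_gt1.
have -> : ln c^-1 = - ln c by rewrite lnV.
have E : ln theta^-1 = - ln theta by rewrite lnV.
rewrite ln_powR -[ln theta]opprK -E mulrN divfK ?gt_eqF //.
Qed.

Lemma gamma_initP (R : realType) (Omega : finType) (omega winit : Omega -> R) s :
  (forall s, 0 < omega s) -> winit s <= gamma_init omega winit * omega s.
Proof.
move=> omega0; rewrite -ler_pdivrMr // /gamma_init.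
exact: (le_bigmax _ (fun s => winit s / omega s)).
Qed.

Lemma gamma_init_gt0 (R : realType) (Omega : finType) (omega winit : Omega -> R) :
  (forall s, 0 < omega s) -> distr winit -> 0 < gamma_init omega winit.
Proof.
move=> omega0 [winit0 winit1].
have [|s /andP[_ ws]] := @psumr_neq0P _ _ xpredT winit (fun s _ => winit0 s).
  by rewrite winit1; apply/eqP; exact: oner_neq0.
by have := lt_le_trans ws (gamma_initP winit s omega0); rewrite pmulr_lgt0.
Qed.

Lemma decay_weight_exists (R : realType) (Omega F : finType)
    (fl : F -> {set Omega}) (rho : F -> Omega -> Omega -> R) (sim : rel F)
    (omega : Omega -> R) (theta : R) (mu : F -> R) :
  flaws_ok fl -> rho_distr fl rho -> pos_distr omega -> sym_rel sim ->
  0 < theta < 1 ->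
  (alg_LLL_cond fl rho sim omega theta mu \/ shearer_cond fl rho sim omega theta mu) ->
  (forall f, 0 < mu f) /\ exists (lam : F -> R) (mh : {set F} -> R),
    [/\ cond_i fl rho omega lam, forall S, 0 <= mh S, mh set0 = 1,
      forall f, mh [set f] = mu f
      & forall S, indep sim S -> S != set0 ->
        lamS lam S *
          (\sum_(A : {set F} | (A \subset GamS sim S) && indep sim A) mh A) <=
        theta * mh S].
Proof.
move=> flP rhoP omegaP simC /andP[t0 t1] [[lam [mu0 [lamP mu_lam]]]|].
  split=> //; exists lam, (fun S : {set F} => \prod_(f in S) mu f); split=> //.
  - by move=> S; exact: muS_ge0.
  - by rewrite big_set0.
  - by move=> f; rewrite big_set1.
  - move=> S _ S0; apply: (lll_decay rhoP omegaP lamP flP) => //.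
    by rewrite !ltW.
case=> p [lam [q_ge0 [q0 [lamP [lam_p ->]]]]].
have t01 : 0 < theta <= 1 by rewrite t0 ltW.
have mhP := shearer_decay rhoP simC omegaP lamP flP t01 q_ge0 lam_p.
have mh_ge0 S : 0 <= qS sim p S / qS sim p set0 by rewrite divr_ge0 // ltW.
have mh0 : qS sim p set0 / qS sim p set0 = 1 by rewrite divff ?gt_eqF.
split=> [f|]; last by exists lam, (fun S => qS sim p S / qS sim p set0); split.
(* Positivity of q_{f}(p) follows from 0 < [lam f] <= [theta * mh [set f]]. *)
have f0 : [set f] != set0 by apply/set0Pn; exists f; rewrite inE.
have := lamS_le rhoP omegaP lamP flP mh_ge0 mh0 mhP (indep1 sim f) f0.
rewrite {1}/lamS big_set1 => /(lt_le_trans (lam_gt0 rhoP omegaP lamP flP f)).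
by rewrite pmulr_rgt0.
Qed.

Theorem theorem2 (R : realType) (Omega F : finType) (fl : F -> {set Omega})
  (rho : F -> Omega -> Omega -> R) (omega : Omega -> R) (sim : rel F)
  (theta : R) (mu : F -> R) (winit : Omega -> R) :
  flaws_ok fl ->
  rho_distr fl rho ->
  pos_distr omega ->
  sym_rel sim ->
  potential_causality fl rho sim ->
  strongly_commutative fl rho sim ->
  0 < theta < 1 ->
  (alg_LLL_cond fl rho sim omega theta mu \/ shearer_cond fl rho sim omega theta mu) ->
  distr winit ->
  forall strat : strategy Omega F, valid_strategy fl sim strat ->
  forall r : R, 0 < Tbound omega winit theta mu + r ->
    1 - theta `^ r <=
    prob_terminates fl rho sim winit strat
      (fun k => k%:R < Tbound omega winit theta mu + r).
Proof.
move=> flP rhoP omegaP simC caus scomm t01 cond winitP strat stratP r x0.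
have [mu0 [lam [mh [lamP mh_ge0 mh0 mh1 mhP]]]] :=
  decay_weight_exists flP rhoP omegaP simC t01 cond.
have [t0 t1] := andP t01; have [omega0 _] := omegaP.
set x := Tbound omega winit theta mu + r in x0 *.
(* [m] will be the least integer that is at least [x], so every [k < m] satisfies [k < x]. *)
have exm : exists n : nat, x <= n%:R.
  by exists (Num.Def.archi_bound x); rewrite ltW // archi_boundP // ltW.
case: (ex_minnP exm) => m xm mmin.
have m0 : (0 < m)%N by rewrite -(ltr0n R); exact: lt_le_trans xm.
have okP k : (k < m)%N -> k%:R < x.
  by rewrite ltNge; apply: contraTN => /mmin; rewrite -leqNgt.
have g0 := gamma_init_gt0 omega0 winitP.
have := prob_fail_le flP rhoP omegaP simC caus scomm lamP winitP stratP (ltW t0)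
  mh_ge0 mh0 mhP (ltW g0) (fun s => gamma_initP winit s omega0) m0 okP.
rewrite lerBlDr => H; rewrite lerBlDr; apply: le_trans H _.
rewrite addrC lerD2l.
under eq_bigr => f _ do rewrite mh1.
(* Without flaws the sum of [mu] has no genuine logarithm, but the failure bound is then 0. *)
have [F0|/card_gt0P[f _]] := posnP #|F|.
  rewrite [X in _ * (_ * X)]big1 ?mulr0 ?powR_ge0 // => f _.
  by move/card0_eq: F0 => /(_ f); rewrite inE.
have M0 : 0 < \sum_f mu f.
  by rewrite (bigD1 f) //= ltr_wpDr // sumr_ge0 // => g _; rewrite ltW.
have tm : theta ^+ m <= theta `^ x.
  by rewrite -powR_mulrn ?(ltW t0) // ger_powR // t0 ltW.
rewrite mulrCA; apply: le_trans (ler_wpM2r _ tm) _.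
  by rewrite mulr_ge0 ?ltW.
(* Since theta^T is the inverse of gamma times the sum of [mu], only theta^r remains. *)
rewrite /x powRD ?gt_eqF ?implybT // /Tbound -lnM ?posrE // powR_ln_div ?mulr_gt0 //.
by rewrite mulrAC mulVf ?mul1r // gt_eqF // mulr_gt0.
Qed.
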